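(* Let $k \in \mathbb{N}^*$ and $n \in \mathbb{N}$ with $n \geq k$. Then $$\binom{n}{k}=\sum_{N_k=1}^{n-k+1}\cdots \sum_{N_1=1}^{N_2} 1=\sum_{N_k=0}^{n-k}\cdots \sum_{N_1=0}^{N_2} 1.$$
   Context: $\mathbb{N}=\{0,1,2,\dots\}$ and $\mathbb{N}^*=\{1,2,\dots\}$. The notation $\sum_{N_k=q}^{M}\cdots\sum_{N_1=q}^{N_2} f(N_1)$ denotes a $k$-fold nested sum: with $N_{k+1}:=M$, the index $N_j$ runs from $q$ to $N_{j+1}$ for $j=k,k-1,\dots,1$; for $k=1$ it is $\sum_{N_1=q}^{M}f(N_1)$. *)

(* Defs.v *)
From mathcomp Require Import all_boot.
Set Implicit Arguments.
Unset Strict Implicit.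
Unset Printing Implicit Defensive.

(* The k-fold sum \sum_{N_k=q}^{M} ... \sum_{N_1=q}^{N_2} f(N_1), peeling off
   the outermost index N_k, which is the upper bound of the next sum.  With
   N_{k+1} := M, the case k = 0 leaves f(N_1) = f(M).  Upper bounds are
   inclusive, whence M.+1 below. *)
Fixpoint nested_sum (q k : nat) (f : nat -> nat) (M : nat) : nat :=
  if k is k'.+1 then \sum_(q <= N < M.+1) nested_sum q k' f N else f M.

(* Main.v *)
Require Import Defs.
From mathcomp Require Import all_boot.

(** Starting the indices at 1 rather than 0 only translates all of them by one,
    so the two nested sums agree by [nested_sum_shift].  The sum from 0 is
    evaluated by peeling off one summation at a time: each turns a column
    [N |-> 'C(N + k, k)] of Pascal's triangle into the next column, by the
    hockey-stick identity [sum_bin_column], starting from the constant column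
    [k = 0]. *)

(** Pascal's rule makes each summand the difference of two consecutive values
    of ['C(N + k, k.+1)], so the sum telescopes. *)
Lemma sum_bin_column k M :
  \sum_(0 <= N < M.+1) 'C(N + k, k) = 'C(M + k.+1, k.+1).
Proof.
elim: M => [|M IHM]; first by rewrite big_nat1 !add0n !binn.
by rewrite big_nat_recr //= IHM addnS -addSn -addSnnS binS.
Qed.

Lemma nested_sum_shift q k f M :
  nested_sum q.+1 k f M.+1 = nested_sum q k (fun N => f N.+1) M.
Proof.
elim: k M => [//|k IHk] M /=.
by rewrite big_add1; apply: eq_bigr => N _; apply: IHk.
Qed.

(** Equivalently, the number of weakly increasing sequences of length [k] with
    values in [{0, ..., M}], i.e. of multisets. *)
Lemma nested_sum0_1 k M : nested_sum 0 k (fun _ => 1) M = 'C(M + k, k).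
Proof.
elim: k M => [|k IHk] M /=; first by rewrite bin0.
by rewrite -sum_bin_column; apply: eq_bigr => N _; apply: IHk.
Qed.

Theorem theorem3p2 (k n : nat) (hk : 1 <= k) (hkn : k <= n) :
  'C(n, k) = nested_sum 1 k (fun _ => 1) (n - k + 1) /\
  nested_sum 1 k (fun _ => 1) (n - k + 1) = nested_sum 0 k (fun _ => 1) (n - k).
Proof.
by rewrite addn1 nested_sum_shift nested_sum0_1 subnK.
Qed.
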